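(* Let $\alpha\ge 0$, $\mu>-\frac12$, $\lambda\ge 0$, $0<\gamma\le 1$ and $M>0$. Let $h:[0,\infty)\to\mathbb{R}$ belong to $Lip_M(\gamma)$, i.e. $|h(s)-h(t)|\le M|s-t|^{\gamma}$ for all $s,t\in[0,\infty)$. Then for every $n\in\mathbb{N}$ and every $x\in[0,\infty)$, $$\left|\mathcal{S}_n(h;x)-h(x)\right|\le M\,(\Lambda_2)^{\gamma/2},$$ where $$\Lambda_2=\mathcal{S}_n((t-x)^2;x)=\frac1n\left[\frac{x^2}{n}\left(4x^2\alpha^2+4\lambda\alpha+10\alpha\right)+2x\left(\mu\frac{e_\mu(-nx)}{e_\mu(nx)}+1\right)+\frac{(\lambda+1)(\lambda+2)}{n}\right].$$
   Context: $\mathbb{N}=\{1,2,3,\dots\}$, $\mathbb{N}_0=\mathbb{N}\cup\{0\}$, and $\Gamma$ is the Gamma function. For $\mu>-\frac12$ and $k\in\mathbb{N}_0$ put $$\gamma_\mu(2k)=\frac{2^{2k}k!\,\Gamma(k+\mu+\frac12)}{\Gamma(\mu+\frac12)},\qquad \gamma_\mu(2k+1)=\frac{2^{2k+1}k!\,\Gamma(k+\mu+\frac32)}{\Gamma(\mu+\frac12)},$$ and let $\theta_k=0$ if $k$ is even, $\theta_k=1$ if $k$ is odd. The Dunkl exponential function is $e_\mu(x)=\sum_{k=0}^\infty \frac{x^k}{\gamma_\mu(k)}$. The Dunkl generalization of the two-variable Hermite polynomials is $$h_k^\mu(\xi,\alpha)=\gamma_\mu(k)\sum_{j=0}^{\lfloor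 k/2\rfloor}\frac{\alpha^j\xi^{k-2j}}{j!\,\gamma_\mu(k-2j)},$$ equivalently $\sum_{k=0}^\infty \frac{h_k^\mu(\xi,\alpha)}{\gamma_\mu(k)}t^k=e^{\alpha t^2}e_\mu(\xi t)$. For $\alpha\ge0$, $\mu>-\frac12$, $\lambda\ge0$, $n\in\mathbb{N}$, $x\in[0,\infty)$ and functions $f$ on $[0,\infty)$ for which the right-hand side makes sense, define $$\mathcal{S}_n(f;x)=\frac{1}{e^{\alpha x^2}e_\mu(nx)}\sum_{k=0}^\infty\frac{h_k^\mu(n,\alpha)}{\gamma_\mu(k)}x^k\,\frac{n^{k+2\mu\theta_k+\lambda+1}}{\Gamma(k+2\mu\theta_k+\lambda+1)}\int_0^\infty t^{k+2\mu\theta_k+\lambda}e^{-nt}f(t)\,dt.$$ In expressions such as $\mathcal{S}_n((t-x)^2;x)$ the operator acts on the function of $t$, with $x$ fixed. *)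

(* Defs.v *)
From HB Require Import structures.
From mathcomp Require Import all_boot all_order all_algebra.
From mathcomp Require Import all_classical all_reals all_analysis.
Set Implicit Arguments.
Unset Strict Implicit.
Unset Printing Implicit Defensive.
Import Order.TTheory GRing.Theory Num.Theory.
Import numFieldNormedType.Exports.
Local Open Scope classical_set_scope.
Local Open Scope ring_scope.

(* Euler's integral; it is meaningful for 0 < z, and is only ever used there
   when -1/2 < mu and 0 <= lambda. *)
Definition Gamma (R : realType) (z : R) : R :=
  Rintegral lebesgue_measure `]0, +oo[ (fun t => t `^ (z - 1) * expR (- t)).

(* gamma_mu(k), both parities at once: with m = k./2,
     k = 2m   : 2^(2m)   m! Gamma(m + mu + 1/2) / Gamma(mu + 1/2)
     k = 2m+1 : 2^(2m+1) m! Gamma(m + mu + 3/2) / Gamma(mu + 1/2) *)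
Definition dunkl_gamma (R : realType) (mu : R) (k : nat) : R :=
  2 ^+ k * (k./2)`!%:R * Gamma ((k./2)%:R + mu + (if odd k then 3 / 2 else 1 / 2))
    / Gamma (mu + 1 / 2).

Definition theta (R : realType) (k : nat) : R := if odd k then 1 else 0.

Definition dunkl_exp (R : realType) (mu x : R) : R :=
  limn (series (fun k => x ^+ k / dunkl_gamma mu k)).

Definition dunkl_hermite (R : realType) (mu : R) (k : nat) (xi alpha : R) : R :=
  dunkl_gamma mu k *
  \sum_(0 <= j < k./2.+1)
    alpha ^+ j * xi ^+ (k - 2 * j) / (j`!%:R * dunkl_gamma mu (k - 2 * j)).

Definition szasz_expo (R : realType) (mu lambda : R) (k : nat) : R :=
  k%:R + 2 * mu * theta R k + lambda.

Definition szasz_integrand (R : realType) (mu lambda : R) (n k : nat)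
    (f : R -> R) (t : R) : R :=
  t `^ szasz_expo mu lambda k * expR (- (n%:R * t)) * f t.

Definition szasz_term (R : realType) (alpha mu lambda : R) (n : nat)
    (f : R -> R) (x : R) (k : nat) : R :=
  dunkl_hermite mu k n%:R alpha / dunkl_gamma mu k * x ^+ k *
  (n%:R `^ (szasz_expo mu lambda k + 1) / Gamma (szasz_expo mu lambda k + 1)) *
  Rintegral lebesgue_measure `[0, +oo[ (szasz_integrand mu lambda n k f).

Definition szasz (R : realType) (alpha mu lambda : R) (n : nat)
    (f : R -> R) (x : R) : R :=
  (expR (alpha * x ^+ 2) * dunkl_exp mu (n%:R * x))^-1 *
  limn (series (szasz_term alpha mu lambda n f x)).

(* [Rintegral] and [limn] are total; this says that the integrals and the
   series defining [szasz] genuinely exist. *)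
Definition szasz_defined (R : realType) (alpha mu lambda : R) (n : nat)
    (f : R -> R) (x : R) : Prop :=
  (forall k, lebesgue_measure.-integrable `[0, +oo[
     (fun t => (szasz_integrand mu lambda n k f t)%:E)) /\
  cvgn (series (szasz_term alpha mu lambda n f x)).

(* A function on [0, +oo[ is represented by a total f : R -> R, whose values at
   negative arguments are unconstrained and never used. *)
Definition Lip (R : realType) (M gamma : R) (f : R -> R) : Prop :=
  forall s t, 0 <= s -> 0 <= t -> `|f s - f t| <= M * `|s - t| `^ gamma.

(* Main.v *)
(** The operator is a mixture of Gamma means. Put d_k = k + 2 mu theta_k. The k-th
    integral with its normalization is the mean of f for the Gamma law of shape
    d_k + lambda + 1 and rate n, whose first two moments are rational in d_k, and
    the weights c_k = h_k x^k / gamma_mu(k) have generating function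
    exp(alpha x^2 t^2) e_mu(n x t). Since gamma_mu(k+1) = d_(k+1) gamma_mu(k) and
    d_(2j+i) = 2j + d_i, the sums of c_k, d_k c_k and d_k^2 c_k reduce to Cauchy
    products of explicit series, which gives Lambda_2.

    The estimate uses the tangent line of the concave function y |-> y^p,
    p = gamma/2, at Lambda_2 instead of two applications of Hoelder's inequality:
    |t - x|^gamma <= Lambda_2^p (1 - p) + p Lambda_2^(p-1) (t - x)^2, and the
    operator maps the right-hand side to Lambda_2^p. Here Lambda_2 > 0 because
    every Gamma law involved has variance at least (lambda + 1) / n^2. *)

Require Import Defs.
From HB Require Import structures.
From mathcomp Require Import all_boot all_order all_algebra.
From mathcomp Require Import all_classical all_reals all_analysis.
From mathcomp Require Import measurable_realfun.
From mathcomp Require Import ring lra zify.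
Import Order.TTheory GRing.Theory Num.Theory.
Import numFieldNormedType.Exports.
Local Open Scope classical_set_scope.
Local Open Scope ring_scope.

(** * Euler's integral *)

Lemma powR_expR_measurable (R : realType) (D : set R) (a r : R) :
  measurable_fun D (fun t : R => t `^ a * expR (- (r * t))).
Proof.
apply: measurable_funTS; apply: measurable_funM; first exact: measurable_powR.
apply: measurableT_comp; first exact: measurable_expR.
by apply: measurableT_comp => //; exact: mulrl_measurable.
Qed.

Lemma powR_expRN_emeasurable (R : realType) (D : set R) (a : R) :
  measurable_fun D (fun t => (t `^ a * expR (- t))%:E).
Proof.
apply/measurable_EFinP; have := powR_expR_measurable R D a 1.
by under eq_fun do rewrite mul1r.
Qed.

Lemma powR_expRN_ge0 (R : realType) (a t : R) : 0 <= t `^ a * expR (- t).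
Proof. by rewrite mulr_ge0 ?powR_ge0 ?expR_ge0. Qed.

Lemma powR_expRN_is_derive (R : realType) (a t : R) : 0 < t ->
  is_derive t 1 (fun t : R => t `^ a * expR (- t))
    (a * (t `^ (a - 1) * expR (- t)) - t `^ a * expR (- t)).
Proof.
move=> t0; have dp := is_derive1_powR a t0.
have de : is_derive t 1 (fun t : R => expR (- t)) (- expR (- t)).
  apply: is_derive_eq.
  by rewrite mulrN1.
have := is_deriveM dp de.
move/is_derive_eq; apply.
by rewrite /= /GRing.scale/=; ring.
Qed.

Lemma powR_expRN_continuous (R : realType) (a t : R) : 0 < t ->
  {for t, continuous (fun t : R => t `^ a * expR (- t))}.
Proof.
move=> t0; apply: differentiable_continuous; apply/derivable1_diffP.
by have [] := powR_expRN_is_derive R a t t0.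
Qed.

(** For t >= 1 and an integer n + 1 >= a, t^a <= t^(n+1), while the exponential series gives exp(t)
    >= t^(n+2) / (n+2)!. The product is thus squeezed below (n+2)! / t. *)
Lemma powR_expRN_cvg0 (R : realType) (a : R) :
  (fun t : R => t `^ a * expR (- t)) @ +oo%R --> (0 : R).
Proof.
pose n := Num.trunc `|a|.
have an : a <= n.+1%:R.
  by rewrite (le_trans (ler_norm _))// ltW// truncnS_gt.
apply: (@squeeze_cvgr _ _ _ _ (fun=> 0) (fun t => n.+2`!%:R * t^-1)); last 2 first.
- exact: cvg_cst.
- rewrite -(mulr0 n.+2`!%:R); apply: cvgM; first exact: cvg_cst.
  apply/gtr0_cvgV0; [|exact: cvg_id]; exact: nbhs_pinfty_gt.
near=> t; have t1 : 1 <= t by near: t; exact: nbhs_pinfty_ge.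
have t0 : 0 < t by rewrite (lt_le_trans _ t1).
rewrite mulr_ge0 ?powR_ge0 ?expR_ge0//= expRN ler_pdivrMr ?expR_gt0//.
have pn : t `^ a <= t ^+ n.+1 by rewrite -powR_mulrn ?(ltW t0)//; exact: ler_powR.
apply: (le_trans pn).
have f0 : 0 < n.+2`!%:R :> R by rewrite ltr0n fact_gt0.
have := expR_ge1Dxn n.+1 (ltW t0); rewrite -/n => H.
have {}H : t ^+ n.+2 / n.+2`!%:R <= expR t by lra.
rewrite mulrAC ler_pdivlMr// -exprSr.
by rewrite mulrC -ler_pdivrMr.
Unshelve. all: by end_near. Qed.

(** Exhausting by compact segments keeps away from the possible singularity of t^(a-1) at 0. The
    shift by 2 makes each segment nondegenerate, as 1/(m+2) < m+2. *)
Lemma itv0y_bigcup (R : realType) :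
  \bigcup_m `[m.+2%:R^-1, m.+2%:R]%classic = `]0, +oo[%classic :> set R.
Proof.
apply/seteqP; split => [t [m _]|t] /=; rewrite !in_itv/= ?andbT.
  by move=> /andP[+ _]; apply: lt_le_trans; rewrite invr_gt0.
move=> t0; pose m := (Num.trunc t + Num.trunc t^-1)%N; exists m => //=.
have ht : t <= m.+2%:R.
  by rewrite (le_trans (ltW (truncnS_gt t)))// ler_nat !ltnS leqW ?leq_addr.
have hi : t^-1 <= m.+2%:R.
  by rewrite (le_trans (ltW (truncnS_gt t^-1)))// ler_nat !ltnS leqW ?leq_addl.
by rewrite in_itv/= ht andbT -[leRHS]invrK lef_pV2 ?posrE ?invr_gt0.
Qed.

Lemma itv_inv_nondecreasing (R : realType) :
  nondecreasing_seq (fun m => `[m.+2%:R^-1, m.+2%:R]%classic : set R).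
Proof.
move=> m k mk; apply/subsetPset => t /=; rewrite !in_itv/= => /andP[t1 t2].
have mk' : m.+2%:R <= k.+2%:R :> R by rewrite ler_nat.
rewrite (le_trans t2 mk') andbT (le_trans _ t1)//.
by rewrite lef_pV2 ?posrE.
Qed.

(* In extended reals, so that finiteness of Euler's integral near 0 is a
   consequence of the recursion instead of a hypothesis. *)
Lemma Gamma_integral_rec (R : realType) (a : R) : 0 < a ->
  (a%:E * \int[lebesgue_measure]_(t in `]0%R, +oo[) (t `^ (a - 1) * expR (- t))%:E
   = \int[lebesgue_measure]_(t in `]0%R, +oo[) (t `^ a * expR (- t))%:E)%E.
Proof.
move=> a0; pose A m : set R := `[m.+2%:R^-1, m.+2%:R]%classic.
pose p t : R := t `^ (a - 1) * expR (- t); pose q t : R := t `^ a * expR (- t).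
have Apos m t : A m t -> 0 < t.
  by rewrite /A/= in_itv/= => /andP[+ _]; apply: lt_le_trans; rewrite invr_gt0.
have cvgA (b : R) :
  (\int[lebesgue_measure]_(t in A m) (t `^ b * expR (- t))%:E)%E @[m --> \oo] -->
  (\int[lebesgue_measure]_(t in `]0%R, +oo[) (t `^ b * expR (- t))%:E)%E.
  rewrite -itv0y_bigcup; apply: ge0_nondecreasing_set_cvg_integral => //.
  - exact: itv_inv_nondecreasing.
  - by move=> m; exact: measurable_itv.
  - by move=> m; exact: powR_expRN_emeasurable.
  - by move=> m t _; rewrite lee_fin powR_expRN_ge0.
have cA (b : R) m : {within A m, continuous (fun t : R => t `^ b * expR (- t))}.
  apply: continuous_in_subspaceT => t /set_mem/Apos t0.
  exact: powR_expRN_continuous.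
have iA (b : R) m : lebesgue_measure.-integrable (A m)
    (EFin \o (fun t : R => t `^ b * expR (- t))).
  by apply: continuous_compact_integrable => //; exact: segment_compact.
(* Integration by parts on a segment, obtained as the fundamental theorem of calculus for [q], whose
   derivative at t > 0 is a p(t) - q(t). *)
have step m : (a%:E * \int[lebesgue_measure]_(t in A m) (p t)%:E =
    \int[lebesgue_measure]_(t in A m) (q t)%:E + (q m.+2%:R - q m.+2%:R^-1)%:E)%E.
  have lt12 : m.+2%:R^-1 < m.+2%:R :> R.
    by rewrite (@lt_trans _ _ 1) ?invf_lt1 ?ltr1n.
  have dq t : A m t -> derivable q t 1.
    by move=> /Apos t0; have [] := powR_expRN_is_derive R a t t0.
  have := @continuous_FTC2 R (fun t => a * p t - q t) q _ _ lt12.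
  rewrite EFinB => <-.
  - under [X in (_ = _ + X)%E]eq_integral do rewrite EFinB EFinM.
    rewrite integralB//=; last 2 first.
      by apply: integrableZl => //; exact: iA.
      exact: iA.
    rewrite integralZl//; last exact: iA.
    rewrite addeC subeK//; apply: integrable_fin_num => //; exact: iA.
  - move=> t; apply: cvgB; last exact: cA.
    by apply: cvgM; [exact: cvg_cst|exact: cA].
  - have cq t : 0 < t -> {for t, continuous q} by exact: powR_expRN_continuous.
    split.
    + move=> t; rewrite in_itv/= => /andP[t1 t2]; apply: dq.
      by rewrite /A/= in_itv/= !ltW.
    + by apply: cvg_at_right_filter; apply: cq; rewrite invr_gt0.
    + by apply: cvg_at_left_filter; exact: cq.
  - move=> t; rewrite in_itv/= => /andP[t1 t2].
    have t0 : 0 < t by rewrite (lt_trans _ t1)// invr_gt0.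
    rewrite derive1E; have := powR_expRN_is_derive R a t t0.
    by move=> [_ ->].
have cy : (fun m => m.+2%:R : R) @ \oo --> +oo%R.
  apply/cvgryPge => M; near=> m.
  rewrite (@le_trans _ _ m%:R)//; last by rewrite ler_nat leqW.
  by near: m; exact: nbhs_infty_ger.
have lim1 : q m.+2%:R @[m --> \oo] --> 0.
  exact: (cvg_comp _ _ cy (powR_expRN_cvg0 R a)).
have lim2 : q m.+2%:R^-1 @[m --> \oo] --> 0.
  apply: (@squeeze_cvgr _ _ _ _ (fun=> 0) (fun m => m.+2%:R^-1 `^ a)).
  - near=> m; rewrite mulr_ge0 ?powR_ge0 ?expR_ge0//= ler_piMr ?powR_ge0//.
  - exact: cvg_cst.
  - have /cvg_at_rightP := powR_cvg0 a0; apply; split=> [m|].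
      by rewrite invr_gt0.
    apply/gtr0_cvgV0; last exact: cy.
    by near=> m.
have R1 : (a%:E * \int[lebesgue_measure]_(t in A m) (p t)%:E)%E @[m --> \oo] -->
   (a%:E * \int[lebesgue_measure]_(t in `]0%R, +oo[) (p t)%:E)%E.
  by apply: cvgeZl => //; exact: cvgA.
have R2 : (\int[lebesgue_measure]_(t in A m) (q t)%:E +
   (q m.+2%:R - q m.+2%:R^-1)%:E)%E @[m --> \oo] -->
   (\int[lebesgue_measure]_(t in `]0%R, +oo[) (q t)%:E + 0%:E)%E.
  (* The limit of the integrals may still be infinite here; the sum makes sense because the boundary
     term has the finite limit 0. *)
  apply: cvgeD; first by rewrite fin_num_adde_defl.
    exact: cvgA.
  by apply: cvg_EFin; [exact: nearW|rewrite -(subrr 0); exact: cvgB].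
rewrite adde0 in R2; apply: (cvg_unique _ R1) => //.
by rewrite (funext step).
Unshelve. all: by end_near. Qed.

Lemma integral_expRN_itvcy (R : realType) (b : R) :
  (\int[lebesgue_measure]_(t in `[b, +oo[) (expR (- t))%:E = (expR (- b))%:E)%E.
Proof.
have cN : continuous (fun t : R => expR (- t)).
  by move=> t; apply: continuous_comp; [exact: oppr_continuous|exact: continuous_expR].
have dN (t : R) : is_derive t (1 : R) (fun t : R => - expR (- t)) (expR (- t)).
  by apply: is_derive_eq; rewrite mulrN1 opprK.
rewrite (@ge0_continuous_FTC2y R _ (fun t => - expR (- t)) b 0).
- by rewrite sub0e EFinN oppeK.
- by move=> t _; exact: expR_ge0.
- exact: continuous_subspaceT.
- by rewrite -oppr0; apply: cvgN; exact: cvgr_expR.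
- by move=> t _; have [] := dN t.
- by apply: cvgN; apply: cvg_at_right_filter; exact: cN.
- by move=> t _; rewrite derive1E; have [_ ->] := dN t.
Qed.

Lemma expRN_emeasurable (R : realType) (D : set R) :
  measurable_fun D (fun t => (expR (- t))%:E).
Proof.
have := powR_expRN_emeasurable R D 0.
by under eq_fun do rewrite powRr0 mul1r.
Qed.

Lemma integral_expRN_itv0y (R : realType) :
  (\int[lebesgue_measure]_(t in `]0%R : R, +oo[) (expR (- t))%:E = 1)%E.
Proof.
rewrite integral_itv_obnd_cbnd ?integral_expRN_itvcy ?oppr0 ?expR0//.
exact: expRN_emeasurable.
Qed.

(** The recursion started at exponent 0 settles natural exponents. A real c >= 0 follows from t^c <=
    1 + t^n with n > c, and exponents down to -1 from one more use of the recursion. *)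
Lemma Gamma_integral_lty (R : realType) (a : R) : -1 < a ->
  (\int[lebesgue_measure]_(t in `]0%R, +oo[) (t `^ a * expR (- t))%:E < +oo)%E.
Proof.
pose G a := (\int[lebesgue_measure]_(t in `]0%R : R, +oo[) (t `^ a * expR (- t))%:E)%E.
have G0 : G 0 = 1%E.
  rewrite -(integral_expRN_itv0y R); apply: eq_integral => t _.
  by rewrite powRr0 mul1r.
have Gn n : (G n%:R < +oo)%E.
  elim: n => [|n IH]; first by rewrite G0 ltry.
  rewrite /G -Gamma_integral_rec ?ltr0n// -[X in X - 1]natr1 addrK -/(G _).
  have G_ge0 : (0 <= G n%:R)%E.
    by apply: integral_ge0 => t _; rewrite lee_fin powR_expRN_ge0.
  by rewrite lte_mul_pinfty ?lee_fin.
have Gpos (c : R) : 0 <= c -> (G c < +oo)%E.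
  move=> c0; pose n := (Num.trunc c).+1.
  apply: (@le_lt_trans _ _ (G 0%R + G n%:R)%E); last by rewrite lte_add_pinfty// G0 ltry.
  rewrite /G -ge0_integralD//; last 4 first.
  - by move=> t _; rewrite lee_fin powR_expRN_ge0.
  - exact: powR_expRN_emeasurable.
  - by move=> t _; rewrite lee_fin powR_expRN_ge0.
  - exact: powR_expRN_emeasurable.
  apply: ge0_le_integral => //.
  - by move=> t _; rewrite lee_fin powR_expRN_ge0.
  - exact: powR_expRN_emeasurable.
  - apply: emeasurable_funD; exact: powR_expRN_emeasurable.
  move=> t; rewrite /= in_itv/= andbT => t0.
  rewrite -EFinD lee_fin -mulrDl ler_wpM2r ?expR_ge0// powRr0.
  have [t1|/ltW t1] := leP t 1.
    have p1 : 1 `^ c = 1 :> R by rewrite powR1.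
    by rewrite ler_wpDr ?powR_ge0// -[leRHS]p1 ge0_ler_powR// nnegrE ltW.
  by rewrite ler_wpDl// ler_powR// ltW// truncnS_gt.
(* The recursion is read backwards: an infinite integral at [a], multiplied by a + 1 > 0, would be
   infinite at a + 1. *)
move=> a1; have a10 : 0 < a + 1 by lra.
have := Gpos (a + 1) (ltW a10).
rewrite /G -(Gamma_integral_rec R _ a10) addrK !ltey; apply: contraNN => /eqP ->.
by rewrite gt0_muley ?lte_fin.
Qed.

(** [Rintegral] sends an infinite integral to a default value; finiteness for z > 0 makes the
    passage to reals faithful. *)
Lemma EFin_Gamma (R : realType) (z : R) : 0 < z ->
  (Gamma z)%:E =
  (\int[lebesgue_measure]_(t in `]0%R, +oo[) (t `^ (z - 1) * expR (- t))%:E)%E.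
Proof.
move=> z0; rewrite /Gamma /Rintegral fineK// ge0_fin_numE.
  by apply: Gamma_integral_lty; lra.
by apply: integral_ge0 => t _; rewrite lee_fin powR_expRN_ge0.
Qed.

Lemma GammaS (R : realType) (z : R) : 0 < z -> Gamma (z + 1) = z * Gamma z.
Proof.
move=> z0; apply: EFin_inj; rewrite EFinM !EFin_Gamma ?addr_gt0//.
by rewrite Gamma_integral_rec// addrK.
Qed.

(** For z >= 1 the integrand is at least exp(-t) on [1, +oo[, so the integral is at least exp(-1).
    Smaller z reduce to z + 1 by the recursion. *)
Lemma Gamma_gt0 (R : realType) (z : R) : 0 < z -> 0 < Gamma z.
Proof.
have Gge1 (y : R) : 1 <= y -> 0 < Gamma y.
  move=> y1; rewrite -lte_fin EFin_Gamma; last by lra.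
  apply: (@lt_le_trans _ _ (\int[lebesgue_measure]_(t in `[1%R, +oo[) (expR (- t))%:E)%E).
    by rewrite integral_expRN_itvcy lte_fin expR_gt0.
  apply: (@le_trans _ _ (\int[lebesgue_measure]_(t in `[1%R, +oo[)
      (t `^ (y - 1) * expR (- t))%:E)%E).
    apply: ge0_le_integral => //.
    - exact: expRN_emeasurable.
    - exact: powR_expRN_emeasurable.
    - move=> t; rewrite /= in_itv/= andbT => t1.
      rewrite lee_fin ler_peMl ?expR_ge0// -[leLHS](powRr0 t) ler_powR//; lra.
  apply: ge0_subset_integral => //.
  - exact: powR_expRN_emeasurable.
  - by move=> t _; rewrite lee_fin powR_expRN_ge0.
  - move=> t; rewrite /= !in_itv/= !andbT; exact: lt_le_trans.
move=> z0; have := Gge1 (z + 1); rewrite GammaS// pmulr_rgt0//; apply; lra.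
Qed.

Lemma integral_powR_expR_scale (R : realType) (a r : R) : 0 <= a -> 0 < r ->
  (\int[lebesgue_measure]_(t in `[0%R, +oo[) (t `^ a * expR (- (r * t)))%:E
   = (Gamma (a + 1) / r `^ (a + 1))%:E)%E.
Proof.
move=> a0 r0; pose g t : R := t `^ a * expR (- t).
have g0 t : 0 <= g t by exact: powR_expRN_ge0.
have cg : {within `[0, +oo[, continuous g}.
  apply/continuous_within_itvcyP; split.
    move=> t; rewrite in_itv/= andbT => t0; exact: powR_expRN_continuous.
  (* Right continuity at 0 splits: t^a is constantly 1 for a = 0, also at t = 0 by the convention on
     [powR], and tends to 0 for a > 0. *)
  apply: cvgM.
    have [<-|a_neq0] := eqVneq 0 a.
      by under eq_fun do rewrite powRr0; rewrite powRr0; exact: cvg_cst.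
    by rewrite powR0 1?eq_sym//; apply: powR_cvg0; rewrite lt_neqAle a_neq0.
  apply: cvg_at_right_filter.
  by apply: continuous_comp; [exact: oppr_continuous|exact: continuous_expR].
pose F t : R := r * t.
have F0 : F 0 = 0 by rewrite /F mulr0.
have dF (t : R) : is_derive t (1 : R) F r.
  by apply: is_derive_eq; rewrite /GRing.scale/= mulr1.
have dF1 : (F^`())%classic = fun=> r.
  by apply/funext => t; rewrite derive1E; have [_ ->] := dF t.
have := @increasing_ge0_integration_by_substitutiony R F g 0.
rewrite F0 dF1 => H.
have {}H : (\int[lebesgue_measure]_(x in `[0%R, +oo[) (g x)%:E =
   \int[lebesgue_measure]_(x in `[0%R, +oo[) (((g \o F) * cst r) x)%:E)%E.
  apply: H => //.
  - by move=> x y _ _ xy; rewrite /F ltr_pM2l.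
  - by move=> x _; exact: cst_continuous.
  - exact: is_cvg_cst.
  - exact: is_cvg_cst.
  - split; first by move=> t _; have [] := dF t.
    by apply: cvg_at_right_filter; exact: mulrl_continuous.
  - exact: gt0_cvgMry.
have rE : (Gamma (a + 1))%:E = ((r `^ (a + 1))%:E *
    \int[lebesgue_measure]_(t in `[0%R, +oo[) (t `^ a * expR (- (r * t)))%:E)%E.
  rewrite EFin_Gamma ?addrK; last by lra.
  rewrite integral_itv_obnd_cbnd; last exact: powR_expRN_emeasurable.
  rewrite H -ge0_integralZl//.
  - apply: eq_integral => t; rewrite inE/= in_itv/= andbT => t0.
    rewrite -EFinM (_ : (_ * cst r)%R t = g (r * t) * r)// /g powRM// ?(ltW r0)// powRD.
      by rewrite powRr1 ?(ltW r0)//; congr EFin; ring.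
    by rewrite (gt_eqF r0) implybT.
  - by apply/measurable_EFinP; exact: powR_expR_measurable.
  - by move=> t _; rewrite lee_fin mulr_ge0 ?powR_ge0 ?expR_ge0.
  - by rewrite lee_fin powR_ge0.
rewrite mulrC EFinM rE muleA -EFinM mulVf ?mul1e//.
by rewrite gt_eqF// powR_gt0.
Qed.

(** * Gamma means *)

(* Mean of f under the Gamma distribution of shape a + 1 and rate r. *)
Definition gamma_mean (R : realType) (a r : R) (f : R -> R) : R :=
  r `^ (a + 1) / Gamma (a + 1) *
  Rintegral lebesgue_measure `[0, +oo[
    (fun t => t `^ a * expR (- (r * t)) * f t).

Section gamma_mean.
Context (R : realType) (a r : R) (a0 : 0 <= a) (r0 : 0 < r).
Local Notation mu := (@lebesgue_measure R).
Local Notation D := (`[0, +oo[%classic : set R).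
Local Notation w := (fun t : R => t `^ a * expR (- (r * t))).

Let w_ge0 t : 0 <= w t. Proof. by rewrite mulr_ge0 ?powR_ge0 ?expR_ge0. Qed.

Let D_ge0 t : D t -> 0 <= t. Proof. by rewrite /= in_itv/= andbT. Qed.

Let mw : measurable_fun D w. Proof. exact: powR_expR_measurable. Qed.

Let a1_gt0 : 0 < a + 1. Proof. by rewrite ltr_wpDl. Qed.

Let G_gt0 : 0 < Gamma (a + 1). Proof. exact: Gamma_gt0. Qed.

Let nrm_gt0 : 0 < r `^ (a + 1) / Gamma (a + 1).
Proof. by rewrite divr_gt0 ?powR_gt0. Qed.

Lemma gamma_weight_exprn_integral j :
  (\int[mu]_(t in D) (w t * t ^+ j)%:E =
   (Gamma (a + j%:R + 1) / r `^ (a + j%:R + 1))%:E)%E.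
Proof.
rewrite -integral_powR_expR_scale ?addr_ge0//.
apply: eq_integral => t; rewrite inE => /D_ge0 t0; congr EFin.
(* The case j = 0 is separate because [powRD] at t = 0 requires a nonzero total exponent. *)
case: j => [|j]; first by rewrite expr0 mulr1 addr0.
by rewrite mulrAC -powR_mulrn// -powRD// gt_eqF// ltr_wpDl.
Qed.

Lemma gamma_weight_exprn_integrable j :
  mu.-integrable D (fun t => (w t * t ^+ j)%:E).
Proof.
apply/integrableP; split.
  by apply/measurable_EFinP; apply: measurable_funM => //; exact: measurable_funX.
under eq_integral => t.
  rewrite inE => /D_ge0 t0.
  rewrite gee0_abs ?lee_fin; last by rewrite mulr_ge0// exprn_ge0.
  over.
by rewrite gamma_weight_exprn_integral ltry.
Qed.

Lemma gamma_mean_exprn j : gamma_mean R a r (fun t => t ^+ j) =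
  Gamma (a + j%:R + 1) / Gamma (a + 1) / r ^+ j.
Proof.
rewrite /gamma_mean /Rintegral gamma_weight_exprn_integral /=.
rewrite addrAC [r `^ (a + 1 + _)]powRD ?(gt_eqF r0) ?implybT// powR_mulrn ?(ltW r0)//.
have := powR_gt0 (a + 1) r0; set p := r `^ _ => p0.
by field; rewrite ?gt_eqF ?exprn_gt0.
Qed.

Lemma gamma_mean0 : gamma_mean R a r (fun=> 1) = 1.
Proof.
have := gamma_mean_exprn 0; rewrite addr0 divff ?gt_eqF//.
by rewrite expr0 divr1.
Qed.

Lemma gamma_mean1 : gamma_mean R a r id = (a + 1) / r.
Proof.
by have := gamma_mean_exprn 1; rewrite GammaS// mulfK ?gt_eqF.
Qed.

Lemma gamma_mean2 : gamma_mean R a r (fun t => t ^+ 2) = (a + 1) * (a + 2) / r ^+ 2.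
Proof.
rewrite gamma_mean_exprn (_ : a + 2%:R + 1 = a + 1 + 1 + 1); last by ring.
rewrite (GammaS _ (a + 1 + 1)); last exact: addr_gt0.
rewrite (GammaS _ (a + 1))//.
by field; rewrite !gt_eqF. 
Qed.

Lemma gamma_weight_quad_integrable (c0 c1 c2 : R) :
  mu.-integrable D (fun t => (w t * (c0 + c1 * t + c2 * t ^+ 2))%:E).
Proof.
have -> : (fun t => (w t * (c0 + c1 * t + c2 * t ^+ 2))%:E) =
    (fun t => c0%:E * (w t * t ^+ 0)%:E)%E \+ (fun t => c1%:E * (w t * t ^+ 1)%:E)%E
    \+ (fun t => c2%:E * (w t * t ^+ 2)%:E)%E.
  by apply/funext => t /=; rewrite -!EFinM -!EFinD; congr EFin; ring.
have iZ c j : mu.-integrable D (fun t => (c%:E * (w t * t ^+ j)%:E)%E).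
  by apply: integrableZl => //; exact: gamma_weight_exprn_integrable.
by apply: integrableD => //; apply: integrableD.
Qed.

Lemma gamma_mean_quad (c0 c1 c2 : R) :
  gamma_mean R a r (fun t => c0 + c1 * t + c2 * t ^+ 2) =
  c0 + c1 * ((a + 1) / r) + c2 * ((a + 1) * (a + 2) / r ^+ 2).
Proof.
rewrite -gamma_mean2 -gamma_mean1 -[in RHS](mulr1 c0) -gamma_mean0 /gamma_mean.
have iE j : mu.-integrable D (EFin \o (fun t => w t * t ^+ j)).
  exact: gamma_weight_exprn_integrable.
have iZ c j : mu.-integrable D (EFin \o (fun t => c * (w t * t ^+ j))).
  rewrite (_ : _ \o _ = (fun t => (c%:E * (w t * t ^+ j)%:E)%E)).
    by apply: integrableZl => //; exact: gamma_weight_exprn_integrable.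
  by apply/funext => t /=; rewrite EFinM.
rewrite (_ : (fun t => _ * (_ + _ + _)) = fun t => c0 * (w t * t ^+ 0) +
  c1 * (w t * t ^+ 1) + c2 * (w t * t ^+ 2)); last by apply/funext => t; ring.
rewrite RintegralD//; last first.
  have := integrableD _ (iZ c0 0%N) (iZ c1 1%N); exact.
rewrite RintegralD// !RintegralZl//=.
have -> : (fun t => w t * t ^+ 0) = (fun t => w t * 1) by [].
have -> : (fun t => w t * t ^+ 1) = (fun t => w t * t) by [].
ring.
Qed.

Lemma gamma_weight_integrable (f : R -> R) (A B x : R) :
  measurable_fun D f -> 
  (forall t, 0 <= t -> `|f t| <= A + B * (t - x) ^+ 2) ->
  mu.-integrable D (fun t => (w t * f t)%:E).
Proof.
move=> mf fAB.
have := gamma_weight_quad_integrable (A + B * x ^+ 2) (- (2 * B * x)) B.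
apply: le_integrable => //.
  by apply/measurable_EFinP; exact: measurable_funM.
move=> t /D_ge0 t0; rewrite lee_fin !normrM ler_wpM2l//.
apply: (le_trans (fAB t t0)); apply: (le_trans _ (ler_norm _)).
lra.
Qed.

(** The law has total mass 1, so y is its own mean and the difference is the mean of f - y; the
    pointwise bound is then integrated. *)
Lemma gamma_mean_dist (f : R -> R) (y A B x : R) :
  measurable_fun D f ->
  (forall t, 0 <= t -> `|f t - y| <= A + B * (t - x) ^+ 2) ->
  `|gamma_mean R a r f - y| <= A + B * gamma_mean R a r (fun t => (t - x) ^+ 2).
Proof.
move=> mf fAB.
have wf : mu.-integrable D (EFin \o (fun t => w t * f t)).
  apply: (gamma_weight_integrable _ (A + `|y|) B x mf) => t t0.
  by rewrite -(subrK y (f t)) (le_trans (ler_normD _ _))// addrAC lerD2r fAB.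
have wq c0 c1 c2 :
    mu.-integrable D (EFin \o (fun t => w t * (c0 + c1 * t + c2 * t ^+ 2))).
  exact: gamma_weight_quad_integrable.
have wy : mu.-integrable D (EFin \o (fun t => w t * y)).
  have := wq y 0 0; congr (mu.-integrable _ _); apply/funext => t /=.
  by rewrite !mul0r !addr0.
have wfy : mu.-integrable D (EFin \o (fun t => w t * (f t - y))).
  apply: eq_integrable (integrableB _ wf wy) => // t _ /=.
  by rewrite -EFinB mulrBr.
have -> : gamma_mean R a r f - y = gamma_mean R a r (fun t => f t - y).
  have {1}-> : y = gamma_mean R a r (fun t => y + 0 * t + 0 * t ^+ 2).
    by rewrite gamma_mean_quad !mul0r !addr0.
  rewrite /gamma_mean -mulrBr -RintegralB//.
  congr (_ * _); apply: eq_Rintegral => t _.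
  by rewrite !mul0r !addr0 mulrBr.
have qE t : A + B * (t - x) ^+ 2 =
    (A + B * x ^+ 2) + (- (2 * B * x)) * t + B * t ^+ 2 by ring.
have qE1 t : (t - x) ^+ 2 = x ^+ 2 + (- (2 * x)) * t + 1 * t ^+ 2 by ring.
have -> : A + B * gamma_mean R a r (fun t => (t - x) ^+ 2) =
    gamma_mean R a r (fun t => A + B * (t - x) ^+ 2).
  by rewrite (funext qE) (funext qE1) !gamma_mean_quad; ring.
rewrite /gamma_mean normrM ger0_norm ?(ltW nrm_gt0)// ler_pM2l//.
apply: (le_trans (le_normr_Rintegral _ wfy)) => //.
apply: le_Rintegral => //.
- have := integrable_norm wfy; exact.
- rewrite (_ : (fun t => w t * _) = fun t => w t *
      (A + B * x ^+ 2 + - (2 * B * x) * t + B * t ^+ 2)); first exact: wq.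
  by apply/funext => t; rewrite qE.
- by move=> t /D_ge0 t0; rewrite normrM (ger0_norm (w_ge0 t)) ler_wpM2l// fAB.
Qed.

(** Squared bias plus variance: the law has mean (a+1)/r and variance (a+1)/r^2. This form also
    shows the lower bound by the variance. *)
Lemma gamma_mean_sqr_dist (x : R) :
  gamma_mean R a r (fun t => (t - x) ^+ 2) =
  ((a + 1) / r - x) ^+ 2 + (a + 1) / r ^+ 2.
Proof.
have -> : (fun t => (t - x) ^+ 2) =
    fun t : R => x ^+ 2 + (- (2 * x)) * t + 1 * t ^+ 2.
  by apply/funext => t; ring.
by rewrite gamma_mean_quad; field; rewrite gt_eqF.
Qed.

End gamma_mean.

(** * Series and Cauchy products *)

Lemma series_cvgS (R : realType) (w : R ^nat) (W : R) :
  series (fun i => w i.+1) @ \oo --> W -> series w @ \oo --> w 0%N + W.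
Proof.
move=> wW; rewrite -cvg_shiftS /=.
have -> : (fun k => series w k.+1) = (fun k => w 0%N + series (fun i => w i.+1) k).
  by apply/funext => k; rewrite /series/= big_nat_recl.
by apply: cvgD => //; exact: cvg_cst.
Qed.

Lemma series_cvgD (R : realType) (u v : R ^nat) (U V : R) :
  series u @ \oo --> U -> series v @ \oo --> V ->
  series (fun k => u k + v k) @ \oo --> U + V.
Proof.
move=> uU vV; rewrite (_ : (fun k => _) = u + v)// seriesD.
exact: cvgD.
Qed.

Lemma series_cvgZ (R : realType) (c : R) (u : R ^nat) (U : R) :
  series u @ \oo --> U -> series (fun k => c * u k) @ \oo --> c * U.
Proof.
move=> uU; rewrite (_ : (fun k => _) = c *: u)// seriesZ.
exact: cvgZl_tmp.
Qed.

(* Coefficients of U(t^2) V(t), where u and v are those of U and V. *)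
Definition conv2 (R : realType) (u v : R ^nat) (k : nat) : R :=
  \sum_(0 <= j < k./2.+1) u j * v (k - 2 * j)%N.

(** Both sides sum u_j v_i over the triangle 2j + i < N. Truncated subtraction makes the inner sum
    empty when 2j >= N, so j may run up to N. *)
Lemma series_conv2 (R : realType) (u v : R ^nat) (N : nat) :
  series (conv2 R u v) N = \sum_(0 <= j < N) u j * series v (N - 2 * j)%N.
Proof.
elim: N => [|N IH]; first by rewrite /series/= !big_geq.
have VS j : series v (N.+1 - 2 * j)%N =
    series v (N - 2 * j)%N + (if (j < N./2.+1)%N then v (N - 2 * j)%N else 0).
  case: ifPn => jN.
    have h : (2 * j <= N)%N by lia.
    by rewrite subSn// seriesSr.
  have h : (N < 2 * j)%N by lia.
  rewrite addr0; congr (series v _); lia.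
rewrite seriesSr IH.
under [in RHS]eq_bigr do rewrite VS mulrDr.
rewrite big_split/= big_nat_recr//= (_ : N - 2 * N = 0)%N; last by lia.
rewrite (_ : series v 0 = 0); last by rewrite /series/= big_geq.
rewrite mulr0 addr0; congr (_ + _).
rewrite /conv2 (big_nat_widen _ N./2.+1 N.+1)/=; last by lia.
rewrite [RHS](bigID (fun j => (j < N./2.+1)%N))/= [X in _ = _ + X]big1.
  by rewrite addr0; apply: eq_bigr => j jN; rewrite jN.
by move=> j /negbTE jN; rewrite jN mulr0.
Qed.

(** With nonnegative terms, the triangle 2j + i < N lies in the square i, j < N, and that square
    lies in the triangle of size 3N. The product of partial sums is therefore squeezed between [C]
    at N and at 3N. *)
Lemma series_conv2_cvg (R : realType) (u v : R ^nat) (U V : R) :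
  (forall k, 0 <= u k) -> (forall k, 0 <= v k) ->
  series u @ \oo --> U -> series v @ \oo --> V ->
  series (conv2 R u v) @ \oo --> U * V.
Proof.
move=> u0 v0 uU vV; pose C := series (conv2 R u v).
have ndu : nondecreasing_seq (series u) by apply: nondecreasing_series => *.
have ndv : nondecreasing_seq (series v) by apply: nondecreasing_series => *.
have sv0 k : 0 <= series v k by rewrite sumr_ge0.
have ndC : nondecreasing_seq C.
  apply: nondecreasing_series => k _ _; rewrite sumr_ge0// => j _.
  by rewrite mulr_ge0.
have CN N : C N <= series u N * series v N.
  rewrite /C series_conv2 /series/= mulr_suml; apply: ler_sum => j _.
  by rewrite ler_wpM2l//; apply: ndv; exact: leq_subr.
(* The factor 3 is chosen so that 3N - 2j >= N for every j < N. *)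
have C3 N : series u N * series v N <= C (3 * N)%N.
  rewrite /C series_conv2 (@big_cat_nat _ _ _ N)//=; last by lia.
  rewrite ler_wpDr//; first by rewrite sumr_ge0// => j _; rewrite mulr_ge0.
  rewrite /series/= mulr_suml; apply: ler_sum_nat => j jN.
  rewrite ler_wpM2l//; apply: ndv; lia.
have uvUV : (series u N * series v N) @[N --> \oo] --> U * V by exact: cvgM.
have cC : cvgn C.
  apply: nondecreasing_is_cvgn => //; exists (U * V) => _ [N _ <-].
  apply: (le_trans (CN N)); apply: ler_pM => //.
  - by rewrite sumr_ge0.
  - by have := nondecreasing_cvgn_le ndu (cvgP _ uU) N; rewrite (cvg_lim _ uU).
  - by have := nondecreasing_cvgn_le ndv (cvgP _ vV) N; rewrite (cvg_lim _ vV).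
have c3 : C (3 * N)%N @[N --> \oo] --> limn C.
  apply: (cvg_comp (fun N => (3 * N)%N)) cC.
  apply/cvgnyPge => M; near=> N; apply: (@leq_trans N); last by lia.
  by near: N; exact: nbhs_infty_ge.
have : (series u N * series v N) @[N --> \oo] --> limn C.
  by apply: (squeeze_cvgr _ cC c3); near=> N; rewrite CN C3.
by move=> /(cvg_unique _ uvUV) ->.
Unshelve. all: by end_near. Qed.

(** * The Dunkl exponential *)

Lemma series_exp_cvg (R : realType) (A : R) :
  series (fun j => A ^+ j / j`!%:R) @ \oo --> expR A.
Proof. exact: is_cvg_series_exp_coeff. Qed.

(** The term at 0 vanishes, and after the index shift the factor j + 1 cancels against (j+1)!. *)
Lemma series_expM_cvg (R : realType) (A : R) :
  series (fun j => j%:R * (A ^+ j / j`!%:R)) @ \oo --> A * expR A.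
Proof.
rewrite -[X in _ --> X]add0r -[X in X + _](mul0r (A ^+ 0 / 0`!%:R)).
apply: series_cvgS; apply: (cvg_trans _ (series_cvgZ _ A _ _ (series_exp_cvg _ A))).
apply: near_eq_cvg; near=> N; apply: eq_bigr => j _.
rewrite factS natrM (exprS A) -natr1.
by field; rewrite natr1 !pnatr_eq0 -lt0n fact_gt0.
Unshelve. all: by end_near. Qed.

Lemma series_expM2_cvg (R : realType) (A : R) :
  series (fun j => j%:R ^+ 2 * (A ^+ j / j`!%:R)) @ \oo --> (A ^+ 2 + A) * expR A.
Proof.
rewrite -[X in _ --> X]add0r -[X in X + _](mul0r (A ^+ 0 / 0`!%:R)).
rewrite -[X in X * _ + _](expr0n _ 2).
have -> : (A ^+ 2 + A) * expR A = A * (A * expR A + expR A) by ring.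
apply: series_cvgS.
have := series_cvgZ _ A _ _
  (series_cvgD _ _ _ _ _ (series_expM_cvg _ A) (series_exp_cvg _ A)).
apply: cvg_trans; apply: near_eq_cvg; near=> N; apply: eq_bigr => j _.
rewrite factS natrM (exprS A) -natr1.
by field; rewrite natr1 !pnatr_eq0 -lt0n fact_gt0.
Unshelve. all: by end_near. Qed.

(* The eigenvalues of t T on the monomials t^k, where T is the Dunkl operator. *)
Definition dunkl_index (R : realType) (mu : R) (k : nat) : R :=
  k%:R + 2 * mu * theta R k.

Section dunkl.
Context (R : realType) (mu : R) (hmu : - (1 / 2) < mu).
Local Notation d := (dunkl_index R mu).
Local Notation g := (dunkl_gamma mu).

Lemma dunkl_index0 : d 0 = 0.
Proof. by rewrite /dunkl_index /theta/= mulr0 addr0. Qed.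

(** The alternating sign, theta_(k+1) - theta_k, is what brings e_mu(-nx) into Lambda_2. *)
Lemma dunkl_indexS k : d k.+1 = d k + 1 + 2 * mu * (-1) ^+ k.
Proof.
rewrite /dunkl_index /theta -natr1 /= -signr_odd.
by case: (odd k) => /=; rewrite ?expr1 ?expr0; ring.
Qed.

(** An even shift preserves parity. This additivity is what makes d_k compatible with [conv2]. *)
Lemma dunkl_index_double j k : d (2 * j + k) = 2 * j%:R + d k.
Proof. by rewrite /dunkl_index /theta oddD oddM /= natrD natrM addrA. Qed.

(** The condition on mu enters for even k, where the value is k + (1 + 2 mu). *)
Lemma dunkl_index_gt (k : nat) : k%:R < d k.+1.
Proof.
rewrite /dunkl_index /theta /= -natr1; have h := hmu; case: (odd k) => /=; last by lra.
by rewrite mulr0 addr0 ltrDl.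
Qed.

Lemma dunkl_index_ge0 k : 0 <= d k.
Proof.
by case: k => [|k]; rewrite ?dunkl_index0// ltW// (le_lt_trans _ (dunkl_index_gt k)).
Qed.

Lemma dunkl_gamma0 : g 0 = 1.
Proof.
rewrite /dunkl_gamma /= expr0 fact0 !mul1r add0r divff// gt_eqF// Gamma_gt0//.
by have h := hmu; lra.
Qed.

(** From k = 2m + 1 the Gamma value is unchanged and the factorial contributes 2(m+1). From k = 2m
    the factorial is unchanged and the recursion of [Gamma] contributes 2(m + mu + 1/2). *)
Lemma dunkl_gammaS k : g k.+1 = d k.+1 * g k.
Proof.
rewrite /dunkl_gamma /dunkl_index /theta /= uphalf_half.
rewrite -[in k.+1%:R](odd_double_half k); case: (odd k) => /=.
  rewrite add1n factS exprS natrM -muln2. rewrite -[k./2.+1%:R]natr1 -[(1 + _).+1%:R]natr1 natrD natrM.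
  rewrite (_ : k./2%:R + 1 + mu + 1 / 2 = k./2%:R + mu + 3 / 2); last by lra.
  by ring.
rewrite !add0n exprS.
rewrite (_ : k./2%:R + mu + 3 / 2 = k./2%:R + mu + 1 / 2 + 1); last by lra.
rewrite GammaS; first rewrite -muln2 -[(_ * 2).+1%:R]natr1 natrM.
  by field; rewrite gt_eqF// Gamma_gt0//; have h := hmu; lra.
have h := hmu; have : 0 <= k./2%:R :> R by []. lra.
Qed.

Lemma dunkl_gamma_gt0 k : 0 < g k.
Proof.
elim: k => [|k IH]; first by rewrite dunkl_gamma0.
by rewrite dunkl_gammaS mulr_gt0// (le_lt_trans _ (dunkl_index_gt k)).
Qed.

(** Factorial growth, for comparison with the exponential series. The induction starts at [g 1]
    because d_1 = 1 + 2 mu is only known to be positive. *)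
Lemma dunkl_gamma_ge k : k`!%:R * g 1 <= g k.+1.
Proof.
elim: k => [|k IH]; first by rewrite fact0 mul1r.
rewrite (dunkl_gammaS k.+1) factS natrM -mulrA; apply: ler_pM => //.
- by rewrite mulr_ge0// ltW// dunkl_gamma_gt0.
- by rewrite ltW// dunkl_index_gt.
Qed.

Definition dunkl_coeff (y : R) (k : nat) : R := y ^+ k / g k.

Lemma dunkl_coeff_ge0 y k : 0 <= y -> 0 <= dunkl_coeff y k.
Proof. by move=> y0; rewrite divr_ge0 ?exprn_ge0// ltW// dunkl_gamma_gt0. Qed.

Lemma dunkl_coeffN y k : dunkl_coeff (- y) k = (-1) ^+ k * dunkl_coeff y k.
Proof. by rewrite /dunkl_coeff (exprNn y) mulrA. Qed.

(** The eigenfunction equation of e_mu for the Dunkl operator, read on coefficients: a factor d is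
    traded for a factor y and an index shift. *)
Lemma dunkl_coeffS y k : d k.+1 * dunkl_coeff y k.+1 = y * dunkl_coeff y k.
Proof.
rewrite /dunkl_coeff dunkl_gammaS exprS.
have := dunkl_gamma_gt0 k; have := le_lt_trans (ler0n _ k) (dunkl_index_gt k).
by move=> d0 g0; field; rewrite !gt_eqF.
Qed.

Lemma dunkl_exp_cvg_ge0 y : 0 <= y -> cvgn (series (dunkl_coeff y)).
Proof.
move=> y0; suff : cvgn (series (fun k => dunkl_coeff y k.+1)).
  by move=> /series_cvgS; exact: cvgP.
have cw := cvgP _ (series_cvgZ _ (y / g 1) _ _ (series_exp_cvg _ y)).
have g1 := dunkl_gamma_gt0 1.
apply: (series_le_cvg _ _ _ cw) => k.
- exact: dunkl_coeff_ge0.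
- by rewrite !mulr_ge0 ?invr_ge0 ?exprn_ge0 ?(ltW g1).
rewrite /dunkl_coeff exprS mulf_div [g 1 * _]mulrC ler_wpM2l//.
  by rewrite mulr_ge0 ?exprn_ge0.
rewrite lef_pV2 ?posrE; first exact: dunkl_gamma_ge.
- exact: dunkl_gamma_gt0.
- by rewrite mulr_gt0// ltr0n fact_gt0.
Qed.

Lemma dunkl_exp_cvg y : series (dunkl_coeff y) @ \oo --> dunkl_exp mu y.
Proof.
have [/dunkl_exp_cvg_ge0//|y0] := leP 0 y.
apply: normed_cvg.
(* For y < 0 the absolute values of the terms are the terms at -y > 0. *)
rewrite (_ : [normed series _] = series (dunkl_coeff (- y))).
  by apply: dunkl_exp_cvg_ge0; rewrite oppr_ge0 ltW.
apply/funext => N; apply: eq_bigr => k _.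
rewrite /= -[in LHS](opprK y) [in LHS]dunkl_coeffN normrM normrX normrN1 expr1n mul1r ger0_norm//.
by rewrite dunkl_coeff_ge0// oppr_ge0 ltW.
Qed.

Lemma dunkl_exp_gt0 y : 0 <= y -> 0 < dunkl_exp mu y.
Proof.
move=> y0; apply: (@lt_le_trans _ _ 1) => //.
have nd : nondecreasing_seq (series (dunkl_coeff y)).
  by apply: nondecreasing_series => k _ _; exact: dunkl_coeff_ge0.
have := nondecreasing_cvgn_le nd (cvgP _ (dunkl_exp_cvg y)) 1%N.
rewrite (cvg_lim _ (dunkl_exp_cvg y))//.
by rewrite /series/= big_nat1 /dunkl_coeff expr0 dunkl_gamma0 divr1.
Qed.

Lemma series_dunkl_coeff1 y :
  series (fun k => d k * dunkl_coeff y k) @ \oo --> y * dunkl_exp mu y.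
Proof.
rewrite -[X in _ --> X]add0r -[X in X + _](mul0r (dunkl_coeff y 0)) -dunkl_index0.
apply: series_cvgS; under eq_fun do rewrite dunkl_coeffS.
by apply: series_cvgZ; exact: dunkl_exp_cvg.
Qed.

(** One factor d_(k+1) is traded for y; the other becomes d_k + 1 + 2 mu (-1)^k, and the sign turns
    the coefficients at y into those at -y. *)
Lemma series_dunkl_coeff2 y :
  series (fun k => d k ^+ 2 * dunkl_coeff y k) @ \oo -->
  y * ((y + 1) * dunkl_exp mu y + 2 * mu * dunkl_exp mu (- y)).
Proof.
set W := y * _; have -> : W = d 0 ^+ 2 * dunkl_coeff y 0 + W.
  by rewrite dunkl_index0 expr0n mul0r add0r.
apply: series_cvgS; rewrite {}/W.
have -> : (fun k => d k.+1 ^+ 2 * dunkl_coeff y k.+1) = fun k =>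
    y * ((d k * dunkl_coeff y k + dunkl_coeff y k) + 2 * mu * dunkl_coeff (- y) k).
  apply/funext => k; rewrite expr2 -mulrA dunkl_coeffS dunkl_coeffN dunkl_indexS.
  ring.
apply: series_cvgZ; apply: series_cvgD; last first.
  by apply: series_cvgZ; exact: dunkl_exp_cvg.
rewrite mulrDl mul1r; apply: series_cvgD; first exact: series_dunkl_coeff1.
exact: dunkl_exp_cvg.
Qed.

End dunkl.

(** * The operator *)

(** After scaling by c this is z^p <= p z + (1 - p) with z = y / c, which is Young's inequality for
    z^p and 1 with exponents 1/p and 1/(1-p). *)
Lemma powR_le_tangent (R : realType) (p c y : R) :
  0 < p -> p < 1 -> 0 < c -> 0 <= y ->
  y `^ p <= c `^ p * (1 - p) + c `^ p * p / c * y.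
Proof.
move=> p0 p1 c0 y0.
have q0 : 0 < 1 - p by rewrite subr_gt0.
have yc0 : 0 <= y / c by rewrite divr_ge0// ltW.
have := @conjugate_powR R ((y / c) `^ p) 1 p^-1 (1 - p)^-1 (powR_ge0 _ _) ler01.
rewrite !invr_gt0 !invrK => /(_ p0 q0) H.
have {}H : (y / c) `^ p <= y / c * p + (1 - p).
  have := H ltac:(ring).
  by rewrite mulr1 -powRrM divff ?gt_eqF// powRr1// powR1 mul1r.
have yE : y = c * (y / c) by rewrite mulrCA divff ?mulr1// gt_eqF.
move: H yc0 yE; set z := y / c => H z0 ->.
rewrite powRM ?(ltW c0)//.
have -> : c `^ p * (1 - p) + c `^ p * p / c * (c * z) =
    c `^ p * (z * p + (1 - p)) by field; rewrite gt_eqF.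
by rewrite ler_wpM2l ?powR_ge0.
Qed.

Lemma powR_norm_sqr (R : realType) (s p : R) : `|s| `^ p = (s ^+ 2) `^ (p / 2).
Proof.
rewrite -real_normK ?num_real// -powR_mulrn// -powRrM.
by congr (_ `^ _); field.
Qed.

(** Hoelder continuity gives measurability. Since h is controlled only on [0, +oo[, continuity is
    taken in the subspace topology. *)
Lemma Lip_measurable (R : realType) (M gamma : R) (h : R -> R) :
  0 < M -> 0 < gamma -> Lip M gamma h -> measurable_fun (`[0, +oo[%classic : set R) h.
Proof.
move=> M0 g0 hL; apply: subspace_continuous_measurable_fun => //.
apply/subspace_continuousP => x; rewrite /= in_itv/= andbT => x0.
apply/cvgrPdist_le => e e0.
(* The solution of M del^gamma = e. *)
pose del := (e / M) `^ gamma^-1.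
have del0 : 0 < del by rewrite powR_gt0// divr_gt0.
have nb : \forall t \near x, `|x - t| < del.
  by have /cvgrPdist_lt := @cvg_id _ (nbhs x); apply.
apply: filterS nb => t xt; rewrite /= in_itv/= andbT => t0.
apply: (le_trans (hL x t x0 t0)).
have -> : e = M * del `^ gamma.
  rewrite -powRrM mulVf ?gt_eqF// powRr1; last by rewrite divr_ge0 ?ltW.
  by rewrite mulrCA divff ?mulr1// gt_eqF.
rewrite ler_pM2l//; apply: ge0_ler_powR => //; rewrite ?nnegrE//; exact: ltW.
Qed.

(* The weights h_k x^k / gamma_mu(k) are the coefficients of
   exp(alpha x^2 t^2) e_mu(n x t), here the convolution c. *)
Section szasz.
Context (R : realType) (alpha mu lambda : R) (n : nat) (x : R).
Context (halpha : 0 <= alpha) (hmu : - (1 / 2) < mu) (hlambda : 0 <= lambda).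
Context (hn : (0 < n)%N) (hx : 0 <= x).
Local Notation d := (dunkl_index R mu).
Local Notation A := (alpha * x ^+ 2).
Local Notation y := (n%:R * x).
Local Notation u := (fun j => A ^+ j / j`!%:R).
Local Notation v := (dunkl_coeff R mu y).
Local Notation c := (conv2 R u v).
Local Notation U := (expR A).
Local Notation V := (dunkl_exp mu y).

Let n0 : 0 < n%:R :> R. Proof. by rewrite ltr0n. Qed.
Let A_ge0 : 0 <= A. Proof. by rewrite mulr_ge0// exprn_ge0. Qed.
Let y_ge0 : 0 <= y. Proof. by rewrite mulr_ge0. Qed.
Let u_ge0 j : 0 <= u j. Proof. by rewrite divr_ge0// exprn_ge0. Qed.
Let v_ge0 k : 0 <= v k. Proof. exact: dunkl_coeff_ge0. Qed.
Let c_ge0 k : 0 <= c k.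
Proof. by rewrite sumr_ge0// => j _; rewrite mulr_ge0. Qed.
Let UV_gt0 : 0 < U * V. Proof. by rewrite mulr_gt0 ?expR_gt0// dunkl_exp_gt0. Qed.

(** With k = 2j + m, the monomial alpha^j n^m x^k regroups as (alpha x^2)^j (n x)^m. *)
Lemma dunkl_hermite_conv2 k :
  dunkl_hermite mu k n%:R alpha / dunkl_gamma mu k * x ^+ k = c k.
Proof.
rewrite /dunkl_hermite [_ * \sum_(_ <= _ < _) _]mulrC mulfK; last first.
  by rewrite gt_eqF// dunkl_gamma_gt0.
rewrite mulr_suml; apply: eq_big_nat => j; rewrite ltnS => /andP[_ jk].
set m := (k - 2 * j)%N; have -> : k = (2 * j + m)%N by rewrite /m; lia.
have f0 : 0 < j`!%:R :> R by rewrite ltr0n fact_gt0.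
have g0 := dunkl_gamma_gt0 _ _ hmu m.
rewrite /dunkl_coeff exprD exprM !exprMn.
by field; rewrite !gt_eqF.
Qed.

(** A Leibniz rule: d_(2j+m) = 2j + d_m, so multiplication by d acts as a derivation on the
    convolution. General sequences allow it to be iterated. *)
Let d_conv2 (a b : R ^nat) k : d k * conv2 R a b k =
  conv2 R (fun j => 2 * (j%:R * a j)) b k + conv2 R a (fun i => d i * b i) k.
Proof.
rewrite /conv2 mulr_sumr -big_split/=; apply: eq_big_nat => j.
rewrite ltnS => /andP[_ jk].
set m := (k - 2 * j)%N; have -> : k = (2 * j + m)%N by rewrite /m; lia.
rewrite dunkl_index_double; ring.
Qed.

(** * Moments of orders 0, 1 and 2 of d_k under the weights *)

Lemma series_weight0 : series c @ \oo --> U * V.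
Proof.
apply: series_conv2_cvg => //; first exact: series_exp_cvg.
exact: dunkl_exp_cvg.
Qed.

Let dv_ge0 k : 0 <= d k * v k. Proof. by rewrite mulr_ge0// dunkl_index_ge0. Qed.

Lemma series_weight1 :
  series (fun k => d k * c k) @ \oo --> (2 * A + y) * (U * V).
Proof.
rewrite (funext (d_conv2 u v)).
have -> : (2 * A + y) * (U * V) = 2 * (A * U) * V + U * (y * V) by ring.
apply: series_cvgD; apply: series_conv2_cvg => //.
- by move=> j; do !apply: mulr_ge0 => //.
- by apply: series_cvgZ; exact: series_expM_cvg.
- exact: dunkl_exp_cvg.
- exact: series_exp_cvg.
- exact: series_dunkl_coeff1.
Qed.

Lemma series_weight2 :
  series (fun k => d k ^+ 2 * c k) @ \oo -->
  ((2 * A + y) ^+ 2 + 4 * A + y) * (U * V) + 2 * mu * y * (U * dunkl_exp mu (- y)).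
Proof.
(* The Leibniz rule is applied twice; the two mixed terms coincide. *)
have dE k : d k ^+ 2 * c k =
    conv2 R (fun j => 2 * (j%:R * (2 * (j%:R * u j)))) v k +
    2 * conv2 R (fun j => 2 * (j%:R * u j)) (fun i => d i * v i) k +
    conv2 R u (fun i => d i ^+ 2 * v i) k.
  rewrite expr2 -mulrA d_conv2 mulrDr !d_conv2.
  have -> : (fun i => d i * (d i * v i)) = (fun i => d i ^+ 2 * v i).
    by apply/funext => i; rewrite expr2 mulrA.
  ring.
rewrite (funext dE).
set W := (X in _ --> X).
have {W}-> : W = 4 * ((A ^+ 2 + A) * U) * V + 2 * (2 * (A * U) * (y * V)) +
    U * (y * ((y + 1) * V + 2 * mu * dunkl_exp mu (- y))) by rewrite /W; ring.
apply: series_cvgD; first apply: series_cvgD.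
- apply: series_conv2_cvg => //; last exact: dunkl_exp_cvg.
    by move=> j; do !apply: mulr_ge0 => //.
  have -> : (fun j => 2 * (j%:R * (2 * (j%:R * u j)))) =
      (fun j => 4 * (j%:R ^+ 2 * u j)) by apply/funext => j; ring.
  by apply: series_cvgZ; exact: series_expM2_cvg.
- apply: series_cvgZ; apply: series_conv2_cvg => //.
  + by move=> j; do !apply: mulr_ge0 => //.
  + by apply: series_cvgZ; exact: series_expM_cvg.
  + exact: series_dunkl_coeff1.
- apply: series_conv2_cvg => //.
  + by move=> i; rewrite mulr_ge0// exprn_ge0// dunkl_index_ge0.
  + exact: series_exp_cvg.
  + exact: series_dunkl_coeff2.
Qed.

(** * The second central moment, and estimates for functions of quadratic growth *)

Local Notation a := (szasz_expo mu lambda).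
Local Notation UV := (U * V).
Local Notation sqr := (fun t => (t - x) ^+ 2).

Let a_ge0 k : 0 <= a k.
Proof. by rewrite addr_ge0// dunkl_index_ge0. Qed.

Lemma szasz_termE f k :
  szasz_term alpha mu lambda n f x k = c k * gamma_mean R (a k) n%:R f.
Proof. by rewrite /szasz_term dunkl_hermite_conv2 /gamma_mean [RHS]mulrA. Qed.

(** Squared bias plus variance at shape d_k + lambda + 1 is a quadratic polynomial in d_k; its three
    coefficients multiply the three moments of the weights. *)
Lemma szasz_term_sqr_cvg :
  series (szasz_term alpha mu lambda n sqr x) @ \oo -->
  (x ^+ 2 - 2 * x * (lambda + 1) / n%:R + (lambda + 1) * (lambda + 2) / n%:R ^+ 2) * UV +
  ((2 * lambda + 3) / n%:R ^+ 2 - 2 * x / n%:R) * ((2 * A + y) * UV) +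
  (n%:R ^+ 2)^-1 * (((2 * A + y) ^+ 2 + 4 * A + y) * UV +
     2 * mu * y * (U * dunkl_exp mu (- y))).
Proof.
have -> : szasz_term alpha mu lambda n sqr x = fun k =>
  (x ^+ 2 - 2 * x * (lambda + 1) / n%:R + (lambda + 1) * (lambda + 2) / n%:R ^+ 2) * c k +
  ((2 * lambda + 3) / n%:R ^+ 2 - 2 * x / n%:R) * (d k * c k) +
  (n%:R ^+ 2)^-1 * (d k ^+ 2 * c k).
  apply/funext => k; rewrite szasz_termE gamma_mean_sqr_dist//.
  rewrite (_ : a k = d k + lambda)//.
  by field; rewrite gt_eqF.
apply: series_cvgD; first apply: series_cvgD; apply: series_cvgZ.
- exact: series_weight0.
- exact: series_weight1.
- exact: series_weight2.
Qed.

(** Since y / n = x, the leading terms collapse: (x - (2A + y)/n)^2 = 4 alpha^2 x^4 / n^2. *)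
Lemma szasz_sqrE : szasz alpha mu lambda n sqr x =
  n%:R^-1 *
    (x ^+ 2 / n%:R * (4 * x ^+ 2 * alpha ^+ 2 + 4 * lambda * alpha + 10 * alpha)
     + 2 * x * (mu * (dunkl_exp mu (- y) / V) + 1)
     + (lambda + 1) * (lambda + 2) / n%:R).
Proof.
rewrite /szasz (cvg_lim _ szasz_term_sqr_cvg)//.
have V0 : 0 < V by exact: dunkl_exp_gt0.
have U0 : 0 < U by exact: expR_gt0.
by field; rewrite !gt_eqF.
Qed.

Lemma szasz_sqr_lim : limn (series (szasz_term alpha mu lambda n sqr x)) =
  UV * szasz alpha mu lambda n sqr x.
Proof. by rewrite /szasz mulrA divff ?mul1r// gt_eqF. Qed.

(** The comparison is made termwise in the series, because the summand with mu e_mu(-y) / e_mu(y) in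
    the closed form has no evident sign. *)
Lemma szasz_sqr_gt0 : 0 < szasz alpha mu lambda n sqr x.
Proof.
rewrite -(pmulr_rgt0 _ UV_gt0) -szasz_sqr_lim.
pose e := (lambda + 1) / n%:R ^+ 2.
have l1 : 0 < lambda + 1 by rewrite ltr_wpDl.
have e0 : 0 < e by rewrite divr_gt0// exprn_gt0.
have ec := series_cvgZ _ e _ _ series_weight0.
apply: (@lt_le_trans _ _ (e * UV)); first by rewrite mulr_gt0.
rewrite -(cvg_lim _ ec)//.
apply: lim_series_le; [exact: cvgP ec|exact: cvgP szasz_term_sqr_cvg|move=> k].
rewrite szasz_termE mulrC ler_wpM2l// gamma_mean_sqr_dist//.
rewrite ler_wpDl ?sqr_ge0// ler_pM2r ?invr_gt0 ?exprn_gt0//.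
by rewrite lerD2r lerDr dunkl_index_ge0.
Qed.

(** The value z is subtracted inside each Gamma mean, so that the bound for a single mean dominates
    the series absolutely. This yields existence and the estimate together; z returns with total
    weight [UV]. *)
Lemma szasz_dist (f : R -> R) (z a0 b0 : R) :
  measurable_fun (`[0, +oo[%classic : set R) f ->
  (forall t, 0 <= t -> `|f t - z| <= a0 + b0 * (t - x) ^+ 2) ->
  szasz_defined alpha mu lambda n f x /\
  `|szasz alpha mu lambda n f x - z| <= a0 + b0 * szasz alpha mu lambda n sqr x.
Proof.
move=> mf fab; pose G k := gamma_mean R (a k) n%:R f.
pose w k := a0 * c k + b0 * szasz_term alpha mu lambda n sqr x k.
have wcvg : series w @ \oo --> a0 * UV + b0 * (UV * szasz alpha mu lambda n sqr x).
  apply: series_cvgD; apply: series_cvgZ; first exact: series_weight0.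
  by rewrite -szasz_sqr_lim; exact: cvgP szasz_term_sqr_cvg.
have dist k : `|c k * (G k - z)| <= w k.
  rewrite normrM ger0_norm// /w szasz_termE.
  rewrite (_ : _ + _ = c k * (a0 + b0 * gamma_mean R (a k) n%:R sqr)); last by ring.
  by rewrite ler_wpM2l//; exact: gamma_mean_dist.
have ncvg : cvgn [normed series (fun k => c k * (G k - z))].
  apply: (series_le_cvg _ _ dist (cvgP _ wcvg)) => k //.
  exact: le_trans (normr_ge0 _) (dist k).
have Tcvg : series (szasz_term alpha mu lambda n f x) @ \oo -->
    limn (series (fun k => c k * (G k - z))) + z * UV.
  rewrite (_ : szasz_term alpha mu lambda n f x =
      fun k => c k * (G k - z) + z * c k).
    by apply: series_cvgD; [exact: normed_cvg|apply: series_cvgZ; exact: series_weight0].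
  by apply/funext => k; rewrite szasz_termE -/(G k); ring.
split.
  split=> [k|]; last exact: cvgP Tcvg.
  apply: (gamma_weight_integrable R (a k) n%:R (a_ge0 k) n0 f (a0 + `|z|) b0 x mf) => t t0.
  by rewrite -(subrK z (f t)) (le_trans (ler_normD _ _))// addrAC lerD2r fab.
rewrite [szasz _ _ _ _ f _]/szasz (cvg_lim _ Tcvg)// mulrDr [z * _]mulrC.
rewrite mulKf ?gt_eqF// addrK normrM gtr0_norm ?invr_gt0// ler_pdivrMl//.
apply: (le_trans (lim_series_norm ncvg)).
have -> : UV * (a0 + b0 * szasz alpha mu lambda n sqr x) = limn (series w).
  by rewrite (cvg_lim _ wcvg)//; ring.
by apply: lim_series_le => //; exact: cvgP wcvg.
Qed.

End szasz.

Theorem theorem2 (R : realType) (alpha mu lambda gamma M : R)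
    (halpha : 0 <= alpha) (hmu : - (1 / 2) < mu) (hlambda : 0 <= lambda)
    (hgamma0 : 0 < gamma) (hgamma1 : gamma <= 1) (hM : 0 < M)
    (h : R -> R) (hLip : Lip M gamma h)
    (n : nat) (hn : (0 < n)%N) (x : R) (hx : 0 <= x) :
  let Lambda2 := szasz alpha mu lambda n (fun t => (t - x) ^+ 2) x in
  [/\ szasz_defined alpha mu lambda n h x,
      szasz_defined alpha mu lambda n (fun t => (t - x) ^+ 2) x,
      Lambda2 = n%:R^-1 *
        (x ^+ 2 / n%:R *
           (4 * x ^+ 2 * alpha ^+ 2 + 4 * lambda * alpha + 10 * alpha)
         + 2 * x *
           (mu * (dunkl_exp mu (- (n%:R * x)) / dunkl_exp mu (n%:R * x)) + 1)
         + (lambda + 1) * (lambda + 2) / n%:R)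
    & `|szasz alpha mu lambda n h x - h x| <= M * Lambda2 `^ (gamma / 2)].
Proof.
move=> Lambda2; pose p := gamma / 2.
have L0 : 0 < Lambda2 by exact: szasz_sqr_gt0.
have p0 : 0 < p by rewrite /p; lra.
have p1 : p < 1 by rewrite /p; lra.
(* The tangent inequality at c = [Lambda2], evaluated at (t - x)^2, whose power p is |t -
   x|^gamma. *)
have hdist t : 0 <= t -> `|h t - h x| <= M * (Lambda2 `^ p * (1 - p)) +
    M * (Lambda2 `^ p * p / Lambda2) * (t - x) ^+ 2.
  move=> t0; rewrite (le_trans (hLip t x t0 hx))// powR_norm_sqr.
  by rewrite -mulrA -mulrDr ler_pM2l// powR_le_tangent// sqr_ge0.
have mh := Lip_measurable R M gamma h hM hgamma0 hLip.
have [dh Hh] := szasz_dist R alpha mu lambda n x halpha hmu hlambda hn hx h _ _ _ mh hdist.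
have msqr : measurable_fun (`[0, +oo[%classic : set R) (fun t => (t - x) ^+ 2).
  by apply: measurable_funX; apply: measurable_funB => //; exact: measurable_id.
(* A trivial bound that serves to obtain the existence of the operator at the square itself. *)
have sqr_dist t : 0 <= t -> `|(t - x) ^+ 2 - 0| <= 0 + 1 * (t - x) ^+ 2.
  by move=> _; rewrite subr0 add0r mul1r ger0_norm// sqr_ge0.
have [dsqr _] := szasz_dist R alpha mu lambda n x halpha hmu hlambda hn hx
  (fun t => (t - x) ^+ 2) _ _ _ msqr sqr_dist.
split=> //; first exact: szasz_sqrE.
(* The tangent line meets the curve at its point of contact, so equality holds here. *)
apply: (le_trans Hh); rewrite -/Lambda2 -/p le_eqVlt; apply/orP; left; apply/eqP.
by field; rewrite gt_eqF.
Qed.
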